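(* Let $W\in\mathbb{R}^{n\times n}$ be symmetric positive definite, let $T\in\mathbb{R}^{n\times n}$ be symmetric, indefinite and nonsingular, let $A=W+\mathrm{i}T$, and let $\alpha>0$. Let $$\mathcal{P}_{PLW}=\mathrm{i}\,\frac{\alpha+1}{\alpha}\,T,\qquad Z=W^{1/2}T^{-1}W^{1/2}.$$ Let $\xi_1,\dots,\xi_n$ be the eigenvalues of the real symmetric matrix $Z$ and let $q_1,\dots,q_n\in\mathbb{R}^n$ be corresponding orthonormal eigenvectors. Then the eigenvalues of $\mathcal{P}_{PLW}^{-1}A$ are $$\eta_{W,j}=\frac{\alpha}{\alpha+1}\,(1-\mathrm{i}\xi_j),\qquad j=1,\dots,n,$$ with corresponding eigenvectors $x_{W,j}=W^{-1/2}q_j$, $j=1,\dots,n$. Therefore $\mathcal{P}_{PLW}^{-1}A=X_W\Lambda_WX_W^{-1}$, where $X_W=(x_{W,1},\dots,x_{W,n})\in\mathbb{R}^{n\times n}$ and $\Lambda_W=\mathrm{diag}(\eta_{W,1},\dots,\eta_{W,n})\in\mathbb{C}^{n\times n}$, and $\kappa_2(X_W)=\sqrt{\kappa_2(W)}$.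
   Context: A real symmetric matrix is indefinite if it has at least one positive and at least one negative eigenvalue. $W^{1/2}$ is the symmetric positive definite square root of $W$, and $\kappa_2(X)=\|X\|_2\|X^{-1}\|_2$ is the spectral condition number. *)

(* Defs.v *)
From HB Require Import structures.
From mathcomp Require Import all_boot all_order all_algebra.
From mathcomp Require Import boolp classical_sets reals.
From mathcomp Require Import complex.

Set Implicit Arguments.
Unset Strict Implicit.
Unset Printing Implicit Defensive.

Import Order.TTheory GRing.Theory Num.Theory.

Local Open Scope classical_set_scope.
Local Open Scope ring_scope.
Local Open Scope complex_scope.

Definition spd (R : realType) (n : nat) (M : 'M[R]_n) : Prop :=
  M \is symmetricmx /\
  forall x : 'cV[R]_n, x != 0 -> 0 < (x^T *m M *m x) 0 0.

(* [eigenvalue] is the library notion, phrased with row eigenvectors; for a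
   square matrix it has the same eigenvalues as with column eigenvectors. *)
Definition indefinite (R : realType) (n : nat) (M : 'M[R]_n) : Prop :=
  (exists2 a : R, 0 < a & eigenvalue M a) /\
  (exists2 b : R, b < 0 & eigenvalue M b).

(* W^{1/2}: the s.p.d. square root, which exists and is unique when W is
   s.p.d.; the default 0 is only reached when no such root exists. *)
Definition sqrtmx (R : realType) (n : nat) (W : 'M[R]_n) : 'M[R]_n :=
  xget 0 [set S : 'M[R]_n | spd S /\ S *m S = W].

Definition norm2 (R : realType) (n : nat) (x : 'cV[R]_n) : R :=
  Num.sqrt (\sum_i x i 0 ^+ 2).

(* For n > 0 this is the maximum over the unit sphere. *)
Definition mxnorm2 (R : realType) (n : nat) (M : 'M[R]_n) : R :=
  sup [set norm2 (M *m x) | x in [set x : 'cV[R]_n | norm2 x = 1]].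

Definition kappa2 (R : realType) (n : nat) (M : 'M[R]_n) : R :=
  mxnorm2 M * mxnorm2 (invmx M).

(* lam lists the eigenvalues of M with their algebraic multiplicities. *)
Definition eigenvalues_of (F : fieldType) (n : nat) (M : 'M[F]_n)
    (lam : 'I_n -> F) : Prop :=
  char_poly M = \prod_(j < n) ('X - (lam j)%:P).

Definition right_eigenvector (F : fieldType) (n : nat) (M : 'M[F]_n)
    (a : F) (x : 'cV[F]_n) : Prop :=
  x != 0 /\ M *m x = a *: x.

Definition orthonormal_family (R : realType) (n : nat)
    (q : 'I_n -> 'cV[R]_n) : Prop :=
  forall i j, ((q i)^T *m q j) 0 0 = (i == j)%:R.

Definition complexmx (R : realType) (m n : nat) (M : 'M[R]_(m, n)) :
  'M[R[i]]_(m, n) := map_mx (real_complex R) M.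

Definition mx_of_cols (F : fieldType) (n : nat) (x : 'I_n -> 'cV[F]_n) :
  'M[F]_n := \matrix_(i, j) x j i 0.

(* Main.v *)
(** With [S = W^{1/2}], [P^{-1} A = b (1 - i T^{-1} W)], [b = alpha / (alpha + 1)],
    and [T^{-1} W = S^{-1} Z S]; so an orthonormal eigenbasis [Q] of [Z] gives the
    eigenbasis [X = S^{-1} Q].  Orthogonal factors do not change the spectral
    condition number, so [kappa2 X = kappa2 S], and [|S|^2 = |S^2|] for symmetric
    [S] gives [kappa2 S ^ 2 = kappa2 W]. *)
Require Import Defs.
From HB Require Import structures.
From mathcomp Require Import all_boot all_order all_algebra.
From mathcomp Require Import boolp classical_sets reals.
From mathcomp Require Import complex.
From mathcomp Require Import ring lra.

Set Implicit Arguments.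
Unset Strict Implicit.
Unset Printing Implicit Defensive.

Import Order.TTheory GRing.Theory Num.Theory.

Local Open Scope ring_scope.
Local Open Scope complex_scope.

(** * Euclidean norm and the Cauchy-Schwarz inequality *)

Lemma norm2_ge0 (R : realType) (n : nat) (x : 'cV[R]_n) : 0 <= norm2 x.
Proof. exact: sqrtr_ge0. Qed.

Lemma norm2_sqr (R : realType) (n : nat) (x : 'cV[R]_n) :
  norm2 x ^+ 2 = (x^T *m x) 0 0.
Proof.
rewrite sqr_sqrtr; last by apply: sumr_ge0 => i _; exact: sqr_ge0.
by rewrite mxE; apply: eq_bigr => i _; rewrite mxE expr2.
Qed.

Lemma norm2_eq0 (R : realType) (n : nat) (x : 'cV[R]_n) :
  (norm2 x == 0) = (x == 0).
Proof.
rewrite sqrtr_eq0 le_eqVlt ltNge sumr_ge0 /= => [|i _]; last exact: sqr_ge0.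
rewrite orbF psumr_eq0 => [|i _]; last exact: sqr_ge0.
apply/allP/eqP => [h|-> i _]; last by rewrite mxE expr0n /= eqxx.
apply/colP => i; rewrite mxE.
by have := h i (mem_index_enum i); rewrite sqrf_eq0 => /eqP.
Qed.

Lemma norm2_gt0 (R : realType) (n : nat) (x : 'cV[R]_n) :
  (0 < norm2 x) = (x != 0).
Proof. by rewrite lt_def norm2_ge0 andbT norm2_eq0. Qed.

Lemma norm2_0 (R : realType) (n : nat) : norm2 (0 : 'cV[R]_n) = 0.
Proof. by apply/eqP; rewrite norm2_eq0. Qed.

Lemma norm2Z (R : realType) (n : nat) (a : R) (x : 'cV[R]_n) :
  norm2 (a *: x) = `|a| * norm2 x.
Proof.
rewrite /norm2 -sqrtr_sqr -sqrtrM ?sqr_ge0 // mulr_sumr; congr (Num.sqrt _).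
by apply: eq_bigr => i _; rewrite mxE exprMn.
Qed.

(** Expand the squared norm of [norm2 y *: x - norm2 x *: y]; zero vectors are split off first so
    that the common factor [norm2 x * norm2 y] can be cancelled. *)
Lemma dot_le_norm2 (R : realType) (n : nat) (x y : 'cV[R]_n) :
  (x^T *m y) 0 0 <= norm2 x * norm2 y.
Proof.
have [->|y0] := eqVneq y 0; first by rewrite mulmx0 mxE norm2_0 mulr0.
have [->|x0] := eqVneq x 0; first by rewrite trmx0 mul0mx mxE norm2_0 mul0r.
rewrite -norm2_gt0 in x0; rewrite -norm2_gt0 in y0.
have : 0 <= norm2 (norm2 y *: x - norm2 x *: y) ^+ 2 by apply: sqr_ge0.
have dotC : (y^T *m x) 0 0 = (x^T *m y) 0 0.
  by rewrite -[in LHS](trmxK x) -trmx_mul mxE.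
rewrite norm2_sqr [(_ - _)^T]linearB /= ![(_ *: _)^T]linearZ /= mulmxBl !mulmxBr.
rewrite -!scalemxAl -!scalemxAr.
have mxEB (u v : 'M[R]_1) : (u - v) 0 0 = u 0 0 - v 0 0 by rewrite !mxE.
have mxEZ c (u : 'M[R]_1) : (c *: u) 0 0 = c * u 0 0 by rewrite mxE.
rewrite !(mxEB, mxEZ) dotC -!norm2_sqr => h.
have := mulr_gt0 x0 y0; move: h; move: (norm2 x) (norm2 y) (_ 0 0) => a b c h ab.
by rewrite -(ler_pM2l ab); nra.
Qed.

(** Cauchy-Schwarz on each row. This Frobenius bound shows that the set whose supremum defines
    [mxnorm2] is bounded above. *)
Lemma norm2_mulmx_le (R : realType) (n : nat) (M : 'M[R]_n) (x : 'cV[R]_n) :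
  norm2 (M *m x) <= Num.sqrt (\sum_i norm2 (row i M)^T ^+ 2) * norm2 x.
Proof.
have F0 : 0 <= \sum_i norm2 (row i M)^T ^+ 2.
  by apply: sumr_ge0 => i _; exact: sqr_ge0.
rewrite -[X in _ * X]ger0_norm ?norm2_ge0 // -sqrtr_sqr -sqrtrM //.
rewrite [norm2 (_ *m _)]/norm2 ler_sqrt ?(mulr_ge0 F0 (sqr_ge0 _)) //.
rewrite mulr_suml; apply: ler_sum => i _.
rewrite -exprMn -ler_sqrt ?sqr_ge0 // !sqrtr_sqr.
rewrite [leRHS]ger0_norm ?mulr_ge0 ?norm2_ge0 //.
have Mxi : (M *m x) i 0 = ((row i M)^T^T *m x) 0 0.
  by rewrite trmxK -row_mul [RHS]mxE.
rewrite Mxi ler_norml dot_le_norm2 andbT lerNl.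
have := dot_le_norm2 (row i M)^T (- x).
by rewrite -[in norm2 (- _)]scaleN1r norm2Z normrN1 mul1r mulmxN mxE.
Qed.

(** * Spectral norm *)

Lemma norm2_le_mxnorm2 (R : realType) (n : nat) (M : 'M[R]_n) (x : 'cV[R]_n) :
  norm2 (M *m x) <= mxnorm2 M * norm2 x.
Proof.
have [->|x0] := eqVneq x 0; first by rewrite mulmx0 norm2_0 mulr0.
have nx : 0 < norm2 x by rewrite norm2_gt0.
rewrite -ler_pdivrMr //; apply: ub_le_sup.
  exists (Num.sqrt (\sum_i norm2 (row i M)^T ^+ 2)) => _ [y /= y1 <-].
  by rewrite -[leRHS]mulr1 -y1; exact: norm2_mulmx_le.
exists ((norm2 x)^-1 *: x);
  rewrite /= -?scalemxAr norm2Z ger0_norm ?invr_ge0 1?ltW //.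
  by rewrite mulVf // gt_eqF.
by rewrite mulrC.
Qed.

Lemma mxnorm2_le (R : realType) (n : nat) (M : 'M[R]_n) (c : R) :
  0 <= c -> (forall x, norm2 (M *m x) <= c * norm2 x) -> mxnorm2 M <= c.
Proof.
move=> c0 Mc; rewrite /mxnorm2; set A := (X in sup X).
(* The unit sphere is empty when [n = 0]; the supremum is then 0, and [0 <= c] settles the case. *)
have [->|/set0P A0] := eqVneq A set0; first by rewrite sup0.
by apply: ge_sup => // _ [x /= x1 <-]; rewrite -[c]mulr1 -x1.
Qed.

Lemma mxnorm2_ge0 (R : realType) (n : nat) (M : 'M[R]_n) : 0 <= mxnorm2 M.
Proof.
rewrite /mxnorm2; set A := (X in sup X).
have [->|/set0P [_ [x /= x1 _]]] := eqVneq A set0; first by rewrite sup0.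
by have := norm2_le_mxnorm2 M x; rewrite x1 mulr1; apply: le_trans (norm2_ge0 _).
Qed.

Lemma mxnorm2M_le (R : realType) (n : nat) (M N : 'M[R]_n) :
  mxnorm2 (M *m N) <= mxnorm2 M * mxnorm2 N.
Proof.
apply: mxnorm2_le => [|x]; first by rewrite mulr_ge0 ?mxnorm2_ge0.
rewrite -mulmxA (le_trans (norm2_le_mxnorm2 _ _)) // -mulrA.
by rewrite ler_wpM2l ?mxnorm2_ge0 ?norm2_le_mxnorm2.
Qed.

(** Only an inequality, because the norm is 0 in dimension 0. *)
Lemma mxnorm2_isometry_le (R : realType) (n : nat) (Q : 'M[R]_n) :
  Q^T *m Q = 1%:M -> mxnorm2 Q <= 1.
Proof.
move=> QQ; apply: mxnorm2_le => // x.
rewrite mul1r -(ler_pXn2r (ltn0Sn 1)) ?nnegrE ?norm2_ge0 //.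
by rewrite !norm2_sqr trmx_mul -mulmxA (mulmxA _ Q) QQ mul1mx.
Qed.

(** A factor [Q] cannot increase the norm; the reverse inequality is the same fact for the factor
    [Q^T], applied to [M *m Q]. *)
Lemma mxnorm2_mulr_orthogonal (R : realType) (n : nat) (M Q : 'M[R]_n) :
  Q^T *m Q = 1%:M -> mxnorm2 (M *m Q) = mxnorm2 M.
Proof.
move=> QQ; have QQt := mulmx1C QQ.
have le (N U : 'M[R]_n) : U^T *m U = 1%:M -> mxnorm2 (N *m U) <= mxnorm2 N.
  move=> UU; rewrite (le_trans (mxnorm2M_le _ _)) // -[leRHS]mulr1.
  by rewrite ler_wpM2l ?mxnorm2_ge0 ?mxnorm2_isometry_le.
apply/eqP; rewrite eq_le le //= -[leLHS](congr1 _ (mulmx1 M)) -QQt mulmxA.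
by rewrite le // trmxK.
Qed.

Lemma mxnorm2_mull_orthogonal (R : realType) (n : nat) (M Q : 'M[R]_n) :
  Q^T *m Q = 1%:M -> mxnorm2 (Q *m M) = mxnorm2 M.
Proof.
move=> QQ; have QQt := mulmx1C QQ.
have le (N U : 'M[R]_n) : U^T *m U = 1%:M -> mxnorm2 (U *m N) <= mxnorm2 N.
  move=> UU; rewrite (le_trans (mxnorm2M_le _ _)) // -[leRHS]mul1r.
  by rewrite ler_wpM2r ?mxnorm2_ge0 ?mxnorm2_isometry_le.
apply/eqP; rewrite eq_le le //= -[leLHS](congr1 _ (mul1mx M)) -QQ -mulmxA.
by rewrite le // trmxK.
Qed.

(** The nontrivial direction is |Sx|^2 = x^T (S S x) <= |x| |S S x| <= |S S| |x|^2. *)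
Lemma mxnorm2_sqr (R : realType) (n : nat) (S : 'M[R]_n) :
  S^T = S -> mxnorm2 (S *m S) = mxnorm2 S ^+ 2.
Proof.
move=> Ssym; apply/eqP; rewrite eq_le mxnorm2M_le /=.
rewrite -ler_sqrt ?mxnorm2_ge0 // sqrtr_sqr ger0_norm ?mxnorm2_ge0 //.
apply: mxnorm2_le => [|x]; first exact: sqrtr_ge0.
rewrite -(ler_pXn2r (ltn0Sn 1)) ?nnegrE ?mulr_ge0 ?sqrtr_ge0 ?norm2_ge0 //.
rewrite exprMn (sqr_sqrtr (mxnorm2_ge0 _)) norm2_sqr trmx_mul Ssym.
rewrite -mulmxA (mulmxA S) (le_trans (dot_le_norm2 _ _)) // mulrC expr2 mulrA.
by rewrite ler_wpM2r ?norm2_ge0 ?norm2_le_mxnorm2.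
Qed.

(** * Real spectral calculus and the positive definite square root *)

Lemma symmetricmxP (R : fieldType) (n : nat) (M : 'M[R]_n) :
  reflect (M^T = M) (M \is symmetricmx).
Proof.
apply: (iffP (is_hermitianmxP _ _ _)); rewrite expr0 scale1r map_mx_id //.
Qed.

Lemma poly_interpolation (F : fieldType) (s : seq F) (f : F -> F) :
  exists p : {poly F}, {in s, forall x, p.[x] = f x}.
Proof.
elim: s => [|y s [p hp]]; first by exists 0.
have [ys|ys] := boolP (y \in s).
  by exists p => x; rewrite inE => /predU1P[->|]; apply: hp.
(* Newton's step: [w] vanishes at the old nodes but not at [y], so a multiple of it corrects the
   value at [y] alone. *)
pose w := \prod_(z <- s) ('X - z%:P).
have wy : w.[y] != 0 by rewrite -rootE root_prod_XsubC.
exists (p + ((f y - p.[y]) / w.[y])%:P * w) => x; rewrite inE !hornerE.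
case/predU1P => [->|xs]; first by rewrite divfK // addrC subrK.
have /rootP -> : root w x by rewrite root_prod_XsubC.
by rewrite mulr0 addr0 hp.
Qed.

Lemma trmx_horner_mx (R : comNzRingType) (n : nat) (M : 'M[R]_n.+1)
    (p : {poly R}) :
  (horner_mx M p)^T = horner_mx M^T p.
Proof.
elim/poly_ind: p => [|p c IH]; first by rewrite !rmorph0 trmx0.
rewrite !(rmorphD, rmorphM) /= !horner_mx_X !horner_mx_C linearD /= trmx_mul IH.
rewrite tr_scalar_mx; congr (_ + _); apply: comm_mx_horner.
exact: commr_refl.
Qed.

Lemma horner_mx_diagonalized (F : fieldType) (n : nat) (P : 'M[F]_n.+1)
    (d : 'rV[F]_n.+1) (p : {poly F}) :
  P \in unitmx ->
  horner_mx (invmx P *m diag_mx d *m P) p =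
    invmx P *m diag_mx (map_mx (horner p) d) *m P.
Proof. by move=> Pu; rewrite horner_mx_uconjC // horner_mx_diag. Qed.

(* The real spectral theorem in polynomial form; it comes from the complex one,
   and lets functions of [M] be taken as real polynomials in [M]. *)
Lemma symmetricmx_annihilator (R : realType) (n : nat) (M : 'M[R]_n.+1) :
  M \is symmetricmx ->
  exists2 a : 'I_n.+1 -> R, forall i, eigenvalue M (a i) &
    forall p : {poly R}, (forall i, p.[a i] = 0) -> horner_mx M p = 0.
Proof.
move=> Msym; set Mc := complexmx M.
have Mcsym : Mc \is symmetricmx.
  by apply/symmetricmxP; rewrite map_trmx (symmetricmxP _ Msym).
have Mcreal : Mc \is a mxOver Num.real.
  by apply/mxOverP => i j; rewrite mxE complex_real.
have Mch := realsym_hermsym Mcsym Mcreal.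
have := orthomx_spectralP (hermitian_normalmx Mch).
have := hermitian_spectral_diag_real Mch.
have := spectral_unit Mc.
move: (spectralmx Mc) (spectral_diag Mc) => P d Pu dreal McE.
have dE i : (complex.Re (d 0 i))%:C = d 0 i.
  by apply: RRe_real; apply: (mxOverP dreal).
exists (fun i => complex.Re (d 0 i)) => [i|p hp].
  (* Row [i] of [P] is a left eigenvector for [d 0 i], nonzero because [P] is invertible. *)
  rewrite -(eigenvalue_map (real_complex R)) /= dE.
  apply/eigenvalueP; exists (row i P).
    rewrite -/(complexmx M) -/Mc McE -row_mul !mulmxA mulmxV // mul1mx.
    by rewrite row_mul row_diag_mx -scalemxAl -rowE.
  apply: contraTneq Pu => Pi0; rewrite -row_free_unit.
  apply/negP => /row_freePn; apply.
  by exists i; rewrite Pi0 sub0mx.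
(* Over the complex numbers [p] acts on the diagonal factor entrywise, and each entry becomes
   [p.[a i] = 0]. *)
apply: (map_mx_inj (f := real_complex R)) => /=.
rewrite raddf0 map_horner_mx -/(complexmx M) -/Mc McE.
rewrite (horner_mx_diagonalized d _ Pu).
have -> : map_mx (horner (map_poly (real_complex R) p)) d = 0.
  by apply/rowP => i; rewrite mxE [RHS]mxE -dE horner_map hp rmorph0.
by rewrite raddf0 mulmx0 mul0mx.
Qed.

Lemma spd_eigenvalue_gt0 (R : realType) (n : nat) (M : 'M[R]_n) (a : R) :
  spd M -> eigenvalue M a -> 0 < a.
Proof.
case=> _ Mpos /eigenvalueP[v vM v0].
have vt0 : v^T != 0 by rewrite -trmx0 (inj_eq trmx_inj).
have := Mpos _ vt0; rewrite trmxK vM -scalemxAl mxE pmulr_lgt0 //.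
by rewrite -[X in (X *m _)]trmxK -norm2_sqr exprn_gt0 // norm2_gt0.
Qed.

(* Taking a fourth root [N] of [W] makes the positivity of the square root
   [N *m N] immediate: [x^T N N x] is the squared length of [N x]. *)
Lemma spd_sqrt_exists (R : realType) (n : nat) (W : 'M[R]_n) :
  spd W -> exists S : 'M[R]_n, spd S /\ S *m S = W.
Proof.
(* [horner_mx] needs a nonzero dimension; in dimension 0, [W] is its own root. *)
case: n W => [|n] W Wspd.
  by exists W; split; [exact: Wspd | apply/matrixP => -[]].
have [Wsym Wpos] := Wspd.
have [a Wa Wann] := symmetricmx_annihilator Wsym.
have [p pa] := poly_interpolation [seq a i | i : 'I_n.+1]
  (fun x => Num.sqrt (Num.sqrt x)).
pose N := horner_mx W p.
have Nsym : N^T = N by rewrite trmx_horner_mx (symmetricmxP _ Wsym).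
have N4 : (N *m N) *m (N *m N) = W.
  (* The polynomial p^4 - X vanishes at every [a i], since these are positive and [p] takes their
     fourth roots there. *)
  have := Wann (p * p * (p * p) - 'X).
  rewrite rmorphB !rmorphM /= horner_mx_X -/N => NW.
  apply/eqP; rewrite -subr_eq0; apply/eqP/NW => i.
  rewrite hornerD hornerN !hornerM hornerX pa; last first.
    by apply: map_f; rewrite mem_enum.
  have ai0 : 0 <= a i by rewrite ltW // (spd_eigenvalue_gt0 Wspd).
  rewrite -!expr2 !sqr_sqrtr ?sqrtr_ge0 ?subrr //.
exists (N *m N); split => //; split.
  by apply/symmetricmxP; rewrite trmx_mul Nsym.
move=> x x0.
have -> : x^T *m (N *m N) *m x = (N *m x)^T *m (N *m x).
  by rewrite trmx_mul Nsym !mulmxA.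
rewrite -norm2_sqr exprn_gt0 // norm2_gt0.
apply: contraTneq (Wpos x x0) => Nx.
by rewrite -N4 -!mulmxA Nx !mulmx0 mxE ltxx.
Qed.

(** A nonzero vector of the left kernel would make the quadratic form vanish. *)
Lemma spd_unitmx (R : realType) (n : nat) (M : 'M[R]_n) :
  spd M -> M \in unitmx.
Proof.
case=> _ Mpos; rewrite -row_free_unit -kermx_eq0; apply/eqP/row_matrixP => i.
rewrite row0; have vM : row i (kermx M) *m M = 0 by rewrite -row_mul mulmx_ker row0.
apply/eqP; move: (row _ _) vM => v vM; apply: contraTT isT => v0.
have vt0 : v^T != 0 by rewrite -trmx0 (inj_eq trmx_inj).
by have := Mpos _ vt0; rewrite trmxK vM mul0mx mxE ltxx.
Qed.

Lemma sqrtmxP (R : realType) (n : nat) (W : 'M[R]_n) :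
  spd W -> spd (sqrtmx W) /\ sqrtmx W *m sqrtmx W = W.
Proof.
move=> /spd_sqrt_exists ex_S.
exact: (@xgetPex _ 0 [set S : 'M[R]_n | spd S /\ S *m S = W]%classic ex_S).
Qed.

(** * Similarity, condition numbers and matrices of columns *)

Lemma invmxM (R : comUnitRingType) (n : nat) (M N : 'M[R]_n) :
  M \in unitmx -> N \in unitmx -> invmx (M *m N) = invmx N *m invmx M.
Proof.
move=> Mu Nu; have MN1 : M *m N *m (invmx N *m invmx M) = 1%:M.
  by rewrite mulmxA mulmxK // mulmxV.
by rewrite -[LHS]mulmx1 -MN1 mulKmx // unitmx_mul Mu.
Qed.

Lemma char_poly_similar (F : fieldType) (n : nat) (X D : 'M[F]_n) :
  X \in unitmx -> char_poly (X *m D *m invmx X) = char_poly D.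
Proof.
move=> Xu; rewrite /char_poly /char_poly_mx.
have XX : map_mx polyC X *m map_mx polyC (invmx X) = 1%:M.
  by rewrite -map_mxM mulmxV // map_mx1.
rewrite !map_mxM.
have -> : 'X%:M - map_mx polyC X *m map_mx polyC D *m map_mx polyC (invmx X) =
  map_mx polyC X *m ('X%:M - map_mx polyC D) *m map_mx polyC (invmx X).
  by rewrite mulmxBr mulmxBl scalar_mxC -[X in _ = X - _]mulmxA XX mulmx1.
by rewrite !det_mulmx mulrC mulrA -det_mulmx (mulmx1C XX) det1 mul1r.
Qed.

(** The inverse of [M *m Q] is [Q^T *m invmx M], so one norm loses an orthogonal factor on the right
    and the other on the left. *)
Lemma kappa2_mulr_orthogonal (R : realType) (n : nat) (M Q : 'M[R]_n) :
  M \in unitmx -> Q^T *m Q = 1%:M -> kappa2 (M *m Q) = kappa2 M.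
Proof.
move=> Mu QQ; have [Qtu Qu] := mulmx1_unit QQ.
have QV : invmx Q = Q^T by rewrite -[LHS]mul1mx -QQ mulmxK.
rewrite /kappa2 mxnorm2_mulr_orthogonal // invmxM // QV.
by rewrite mxnorm2_mull_orthogonal // trmxK (mulmx1C QQ).
Qed.

Lemma kappa2_invmx (R : realType) (n : nat) (M : 'M[R]_n) :
  kappa2 (invmx M) = kappa2 M.
Proof. by rewrite /kappa2 invmxK mulrC. Qed.

Lemma kappa2_sqr (R : realType) (n : nat) (S : 'M[R]_n) :
  S^T = S -> S \in unitmx -> kappa2 (S *m S) = kappa2 S ^+ 2.
Proof.
move=> Ssym Su; rewrite /kappa2 invmxM // !mxnorm2_sqr ?exprMn //.
by rewrite trmx_inv Ssym.
Qed.

Lemma mulmx_mx_of_cols (F : fieldType) (n : nat) (M : 'M[F]_n)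
    (x : 'I_n -> 'cV[F]_n) :
  M *m mx_of_cols x = mx_of_cols (fun j => M *m x j).
Proof. by apply/matrixP => i j; rewrite !mxE; apply: eq_bigr => k _; rewrite mxE. Qed.

Lemma mx_of_cols_mul_diag (F : fieldType) (n : nat) (a : 'I_n -> F)
    (x : 'I_n -> 'cV[F]_n) :
  mx_of_cols x *m diag_mx (\row_j a j) = mx_of_cols (fun j => a j *: x j).
Proof. by apply/matrixP => i j; rewrite mul_mx_diag !mxE mulrC. Qed.

Lemma orthonormal_mx_of_cols (R : realType) (n : nat) (q : 'I_n -> 'cV[R]_n) :
  orthonormal_family q -> (mx_of_cols q)^T *m mx_of_cols q = 1%:M.
Proof.
move=> qq; apply/matrixP => i j; rewrite [RHS]mxE -qq !mxE.
by apply: eq_bigr => k _; rewrite !mxE.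
Qed.

Theorem theorem4p1 (R : realType) (n : nat) (W T : 'M[R]_n) (alpha : R)
    (xi : 'I_n -> R) (q : 'I_n -> 'cV[R]_n)
    (hW : spd W)
    (hTsym : T \is symmetricmx) (hTindef : indefinite T) (hTunit : T \in unitmx)
    (halpha : 0 < alpha) :
  let A : 'M[R[i]]_n := complexmx W + 'i *: complexmx T in
  let P : 'M[R[i]]_n := ('i * ((alpha + 1) / alpha)%:C) *: complexmx T in
  let Z : 'M[R]_n := sqrtmx W *m invmx T *m sqrtmx W in
  eigenvalues_of Z xi ->
  (forall j, right_eigenvector Z (xi j) (q j)) ->
  orthonormal_family q ->
  let eta : 'I_n -> R[i] :=
    fun j => (alpha / (alpha + 1))%:C * (1 - 'i * (xi j)%:C) in
  let x : 'I_n -> 'cV[R]_n := fun j => invmx (sqrtmx W) *m q j in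
  let X : 'M[R]_n := mx_of_cols x in
  let Lambda : 'M[R[i]]_n := diag_mx (\row_j eta j) in
  [/\ P \in unitmx,
      eigenvalues_of (invmx P *m A) eta,
      forall j, right_eigenvector (invmx P *m A) (eta j) (complexmx (x j)),
      X \in unitmx /\
      invmx P *m A = complexmx X *m Lambda *m invmx (complexmx X)
    & kappa2 X = Num.sqrt (kappa2 W)].
Proof.
move=> A P Z _ Zq /orthonormal_mx_of_cols qq eta x X Lambda.
have [[/symmetricmxP Ssym Spos] SS] := sqrtmxP hW.
have Su : sqrtmx W \in unitmx by apply: spd_unitmx; have [] := sqrtmxP hW.
have XE : X = invmx (sqrtmx W) *m mx_of_cols q by rewrite mulmx_mx_of_cols.
have [_ Qu] := mulmx1_unit qq.
have Xu : X \in unitmx by rewrite XE unitmx_mul unitmx_inv Su.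
have Xcu : complexmx X \in unitmx by rewrite map_unitmx.
have Tcu : complexmx T \in unitmx by rewrite map_unitmx.
have ii : 'i * 'i = -1 :> R[i] by rewrite -expr2 sqr_i.
pose c : R[i] := 'i * ((alpha + 1) / alpha)%:C.
pose b : R[i] := (alpha / (alpha + 1))%:C.
(* [c] is the scalar of [P]; its inverse combines 1/i = -i with the reciprocal fraction [b]. *)
have cV : c * (- 'i * b) = 1.
  rewrite mulrACA mulrN ii opprK mul1r -rmorphM /= -[alpha / _]invf_div mulfV //.
  by rewrite mulf_neq0 ?invr_eq0 ?gt_eqF // addr_gt0.
have cu : c \is a GRing.unit by apply/unitrPr; exists (- 'i * b).
have c_inv : c^-1 = - 'i * b by rewrite -[LHS]mulr1 -cV mulKr.
have Pu : P \in unitmx by rewrite /P unitmxZ.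
(* With S = W^{1/2}, W x_j = S q_j, so T^{-1} W x_j = S^{-1} Z q_j. *)
have TWx j : invmx T *m (W *m x j) = xi j *: x j.
  have Wx : W *m x j = sqrtmx W *m q j.
    by rewrite -[X in X *m _]SS -mulmxA mulKVmx.
  have [_ Zqj] := Zq j.
  by rewrite Wx /x [RHS]scalemxAr -Zqj /Z !mulmxA mulVmx // mul1mx.
have PAx j : invmx P *m A *m complexmx (x j) = eta j *: complexmx (x j).
  have TWxc : invmx (complexmx T) *m (complexmx W *m complexmx (x j)) =
      (xi j)%:C *: complexmx (x j).
    by rewrite -map_invmx -!map_mxM TWx map_mxZ.
  (* The eigenvalue comes out as -i b (xi_j + i) = b (1 - i xi_j). *)
  rewrite -mulmxA /A mulmxDl /P -/c invmxZ // -!scalemxAl mulmxDr -scalemxAr TWxc.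
  rewrite mulKmx // -scalerDl scalerA c_inv; congr (_ *: _).
  by rewrite /eta -/b -[1]opprK -ii; ring.
have PAE : invmx P *m A = complexmx X *m Lambda *m invmx (complexmx X).
  have XcE : complexmx X = mx_of_cols (fun j => complexmx (x j)).
    by apply/matrixP => i j; rewrite !mxE.
  (* After cancelling the inverse, P^{-1} A X = X Lambda is checked column by column. *)
  rewrite -[LHS](mulmxK Xcu); congr (_ *m _).
  rewrite XcE mulmx_mx_of_cols mx_of_cols_mul_diag.
  by congr mx_of_cols; apply/funext => j.
split => //.
(* The multiplicities come from the diagonalization: the characteristic polynomial is that of
   [Lambda]. *)
- rewrite /eigenvalues_of PAE char_poly_similar // char_poly_trig ?diag_mx_is_trig //.
  by apply: eq_bigr => j _; rewrite !mxE eqxx.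
(* [x j] is nonzero because [sqrtmx W] maps it to [q j]. *)
- move=> j; split => //; rewrite map_mx_eq0.
  have [qj0 _] := Zq j; apply: contraNneq qj0 => xj0.
  by rewrite -[q j](mulKVmx Su) -/(x j) xj0 mulmx0.
- rewrite XE kappa2_mulr_orthogonal ?unitmx_inv // kappa2_invmx -[in RHS]SS.
  by rewrite kappa2_sqr // sqrtr_sqr ger0_norm // mulr_ge0 ?mxnorm2_ge0.
Qed.
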